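(* Let $N\ge2$. For SNRs $x_N\ge\dots\ge x_1>0$, let $O$ be a feasible ordering maximizing the common rate, namely $O=\{\{U_1,U_2\},\{U_2,U_3\},\dots,\{U_{N-1},U_N\}\}$, and let $O'$ be an arbitrary feasible ordering. Then $$C_R(G_O)-C_R(G_{O'})\le\frac{1}{2(N-1)}\log_2\left(\frac{1+2x_N}{2x_1}\right).$$ Consequently, if $x_1\to\infty$ with $x_N\sim x_1$ (i.e. $x_N/x_1\to1$), then $$\lim_{x_1\to\infty}\left(C_R(G_O)-C_R(G_{O'})\right)=0.$$
   Context: There are $N\ge2$ users $U_1,\dots,U_N$ with SNRs $x_N\ge\dots\ge x_1>0$ (real numbers). An ordering is a set of unordered pairs of distinct users; its client graph $G_O=(V,E)$ is the simple graph on $V=\{v_1,\dots,v_N\}$ with $v_iv_j\in E$ iff $\{U_i,U_j\}\in O$. Only orderings with $N-1$ pairs are considered; such an ordering is feasible exactly when $G_O$ is a tree. For a feasible ordering $O$, $$B_i(G_O)=\min_{j:\,v_iv_j\in E}\frac{1}{2(N-1)}\log_2\left(x_i+\frac{x_i}{x_i+x_j}\right)$$ is the maximum achievable rate of $U_i$, and $C_R(G_O)=\min_{1\le i\le N}B_i(G_O)$ is the maximum achievable common rate. The limit statement is for fixed $N$ and any family of SNR vectors with $x_1\to\infty$ and $x_N/x_1\to1$; the choice of $O'$ may vary along the family. *)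

(* Defs.v *)
From mathcomp Require Import all_boot all_order all_algebra.
From mathcomp Require Import all_classical all_reals all_analysis.
Import Order.TTheory GRing.Theory Num.Theory.
Import numFieldNormedType.Exports.

Set Implicit Arguments.
Unset Strict Implicit.
Unset Printing Implicit Defensive.

Local Open Scope ring_scope.

Definition log2 (R : realType) (x : R) : R := ln x / ln 2.

(* The bigop's default value is itself an entry of [s], so this is the true
   minimum when [s] is nonempty; the value on [::] is 0, by convention. *)
Definition minseq (R : realType) (s : seq R) : R :=
  \big[Num.min/head 0 s]_(a <- s) a.

Lemma minseq_le (R : realType) (s : seq R) (a : R) :
  a \in s -> minseq s <= a.
Proof. by move=> sa; apply: (ge_bigmin_seq _ a). Qed.

Lemma minseq_mem (R : realType) (s : seq R) : s != [::] -> minseq s \in s.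
Proof.
case: s => // a s _; rewrite /minseq big_seq.
elim/big_ind: _ => [|b c bs cs|//] /=; first exact: mem_head.
by rewrite minEle; case: ifP.
Qed.

Section Ordering.
Variables (R : realType) (N : nat).

(* The user [U_k] is the element of ['I_N] with value [k - 1]. *)
Definition first_user (hN : (2 <= N)%N) : 'I_N := Ordinal (ltnW hN).

Lemma last_user_subproof (hN : (2 <= N)%N) : (N.-1 < N)%N.
Proof. by rewrite ltn_predL ltnW. Qed.

Definition last_user (hN : (2 <= N)%N) : 'I_N :=
  Ordinal (last_user_subproof hN).

Definition snr_vector (x : 'I_N -> R) : Prop :=
  (forall i, 0 < x i) /\ (forall i j : 'I_N, (i <= j)%N -> x i <= x j).

(* An unordered pair of distinct users is a two-element subset of ['I_N]. *)
Definition is_ordering (O : {set {set 'I_N}}) : Prop :=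
  forall p, p \in O -> #|p| = 2%N.

Definition client_graph (O : {set {set 'I_N}}) : rel 'I_N :=
  fun i j => [set i; j] \in O.

(* [ucycle] also accepts the closed walk i - j - i along a single edge (and
   shorter degenerate cycles), hence the lower bound on the length. *)
Definition is_tree (e : rel 'I_N) : Prop :=
  (forall i j, connect e i j) /\
  (forall c : seq 'I_N, (3 <= size c)%N -> ~ ucycle e c).

Definition feasible (O : {set {set 'I_N}}) : Prop :=
  [/\ is_ordering O, #|O| = N.-1 & is_tree (client_graph O)].

Definition link_rate (x : 'I_N -> R) (i j : 'I_N) : R :=
  1 / (2 * (N%:R - 1)) * log2 (x i + x i / (x i + x j)).

Definition user_rate (x : 'I_N -> R) (O : {set {set 'I_N}}) (i : 'I_N) : R :=
  minseq [seq link_rate x i j | j <- enum 'I_N & client_graph O i j].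

Definition common_rate (x : 'I_N -> R) (O : {set {set 'I_N}}) : R :=
  minseq [seq user_rate x O i | i <- enum 'I_N].

End Ordering.

Definition chain_ordering (N : nat) : {set {set 'I_N}} :=
  [set p | [exists i : 'I_N, exists j : 'I_N,
              (j == i.+1 :> nat) && (p == [set i; j])]].

(* Main.v *)
Require Import Defs.
From mathcomp Require Import all_boot all_order all_algebra.
From mathcomp Require Import all_classical all_reals all_analysis.
From mathcomp Require Import zify ring lra.
Import Order.TTheory GRing.Theory Num.Theory.
Import numFieldNormedType.Exports.

Local Open Scope classical_set_scope.
Local Open Scope ring_scope.

(** The rate of a link increases with the SNR of its own user and decreases
with that of the partner. A tree crosses every cut between users [k] and
[k + 1], and a crossing link is no better, for its weaker endpoint, than the
chain link at that cut: hence the chain is optimal. For the gap, the argument of the logarithm is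
at least [x_1] on every link, and at most [x_1 + 1/2] on the chain link of
[U_1]. *)

Lemma eq_set2 (T : finType) (a b c d : T) :
  [set a; b]%SET = [set c; d]%SET ->
  (a = c /\ b = d) \/ (a = d /\ b = c).
Proof.
move=> /setP E.
(* Each of the four elements lies in the other pair; the resulting case split leaves only the two
   matchings. *)
have := E a; have := E b; have := E c; have := E d.
rewrite !inE !eqxx !orbT /=.
by move=> /orP[]/eqP ? /orP[]/eqP ? /esym/orP[]/eqP ? /esym/orP[]/eqP ?;
  subst; auto.
Qed.

(** On a path that starts in [P] and ends outside it, the first step leaving [P] is the required
    edge. *)
Lemma connect_cut (T : finType) (e : rel T) (P : pred T) (i j : T) :
  connect e i j -> P i -> ~~ P j -> exists u v, [/\ e u v, P u & ~~ P v].
Proof.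
move=> /connectP[p ep ->]; elim: p i ep => [|k p IH] i /=.
  by move=> _ ->.
move=> /andP[ik kp] Pi; case: (boolP (P k)) => [Pk|nPk _]; first exact: IH.
by exists i, k.
Qed.

(** * Feasibility of the chain ordering *)

Section Chain.
Variable N : nat.
Implicit Types i j : 'I_N.

Lemma client_graphC (O : {set {set 'I_N}}) : symmetric (client_graph O).
Proof. by move=> i j; rewrite /client_graph finset.setUC. Qed.

Lemma chain_graphE i j :
  client_graph (chain_ordering N) i j =
  (j == i.+1 :> nat) || (i == j.+1 :> nat).
Proof.
rewrite /client_graph inE; apply/existsP/orP.
  move=> [a /existsP[b /andP[/eqP ab /eqP/eq_set2]]].
  by case=> -[-> ->]; [left|right]; apply/eqP.
case=> H; [exists i|exists j]; apply/existsP; [exists j|exists i].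
  by rewrite H eqxx.
by rewrite H finset.setUC eqxx.
Qed.

Lemma chain_is_ordering : is_ordering (chain_ordering N).
Proof.
move=> p; rewrite inE => /existsP[i /existsP[j /andP[/eqP ij /eqP->]]].
rewrite cards2; suff -> : i != j by [].
by apply/eqP => E; move: ij; rewrite E; lia.
Qed.

Lemma card_chain : #|chain_ordering N| = N.-1.
Proof.
case: N => [|n].
  apply/eqP; rewrite cards_eq0; apply/eqP/setP => p; rewrite !inE.
  by apply/negbTE/existsP => -[[]].
pose f (k : 'I_n) : {set 'I_n.+1} := [set widen_ord (leqnSn n) k; lift ord0 k]%SET.
have -> : chain_ordering n.+1 = [set f k | k in [set: 'I_n]]%SET.
  apply/setP => p; rewrite inE; apply/existsP/imsetP.
    move=> [i /existsP[j /andP[/eqP ij /eqP->]]].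
    have lin : (i < n)%N by have := ltn_ord j; lia.
    exists (Ordinal lin); first by rewrite inE.
    by congr [set _; _]%SET; apply: val_inj => //=; rewrite ij.
  move=> [k _ ->]; exists (widen_ord (leqnSn n) k).
  by apply/existsP; exists (lift ord0 k); rewrite !eqxx.
rewrite card_imset ?cardsT ?card_ord // => k l /eq_set2.
case=> -[/(congr1 val)/= H1 /(congr1 val)/= H2]; apply: val_inj => //=.
(* The swapped matching would force both k = l + 1 and l = k + 1. *)
by move: H1 H2; rewrite /bump; lia.
Qed.

Lemma chain_connect i j : connect (client_graph (chain_ordering N)) i j.
Proof.
have connectC := sym_connect_sym (client_graphC (chain_ordering N)).
(* Walk upwards by induction on the distance [k]; symmetry of the graph covers the downward
   direction. *)
have up k : forall i j, (j = i + k :> nat)%N ->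
    connect (client_graph (chain_ordering N)) i j.
  elim: k => [|k IH] a b ab.
    by have -> : a = b by apply: val_inj; rewrite /= ab addn0.
  have ltN : (a + k < N)%N by have := ltn_ord b; lia.
  apply: (connect_trans (IH a (Ordinal ltN) _)) => //.
  by apply: connect1; rewrite chain_graphE /= ab addnS eqxx.
have [ij|ji] := leqP i j; first by apply: (up (j - i)%N); lia.
by rewrite connectC; apply: (up (i - j)%N); lia.
Qed.

(** Both cyclic neighbours of the largest vertex [m] of a cycle are adjacent to [m] and at most [m],
    so both equal m - 1. In a cycle of length at least 3 they are distinct entries, against
    uniqueness. *)
Lemma chain_acyclic (c : seq 'I_N) :
  (3 <= size c)%N -> ~ ucycle (client_graph (chain_ordering N)) c.
Proof.
move=> c3 /andP[cc uc].
have [m0 m0c] : exists m, m \in c by case: c c3 {cc uc} => // a c; exists a; rewrite mem_head.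
case: (arg_maxnP val m0c) => m mc maxm.
have [k c' rotE] := rot_to mc.
move: cc uc c3; rewrite -(rot_cycle k) -(rot_uniq k) -(size_rot k) rotE.
have {}maxm : forall y, y \in m :: c' -> (y <= m)%N.
  by move=> y; rewrite -rotE mem_rot => /maxm.
(* After rotating [m] to the front, its neighbours are the second entry [a] and the last entry [b];
   the length bound rules out shorter shapes. *)
case: c' maxm {rotE} => // a s; case/lastP: s => // s b maxm.
rewrite /= rcons_path last_rcons => /and3P[ma _ bm] /and3P[_ ab _] _.
have am : (a <= m)%N by apply: maxm; rewrite !inE eqxx orbT.
have lbm : (b <= m)%N by apply: maxm; rewrite !inE mem_rcons !inE eqxx !orbT.
have E : a = b.
  by apply: val_inj => /=; move: ma bm; rewrite !chain_graphE; lia.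
by move: ab; rewrite E mem_rcons mem_head.
Qed.

Lemma chain_feasible : feasible (chain_ordering N).
Proof.
split; [exact: chain_is_ordering|exact: card_chain|split].
  exact: chain_connect.
exact: chain_acyclic.
Qed.

End Chain.

(** * Rates as minima over links *)

Section Rates.
Variables (R : realType) (N : nat) (hN : (2 <= N)%N).
Implicit Types (x : 'I_N -> R) (O : {set {set 'I_N}}).

(** As there are at least two users, connectivity gives an edge across the cut that isolates [i].
    Hence no minimum defining a user rate is taken over an empty list. *)
Lemma feasible_neighbor {O} (i : 'I_N) :
  feasible O -> exists j, client_graph O i j.
Proof.
case=> _ _ [conn _].
have [j ji] : exists j, j != i.
  have [->|] := eqVneq i (first_user hN).
    by exists (last_user hN); apply/eqP => /(congr1 val)/=; lia.
  by rewrite eq_sym; exists (first_user hN).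
have [] := @connect_cut _ _ (pred1 i) _ _ (conn i j) (eqxx i) ji.
by move=> u [v [uv /eqP<- _]]; exists v.
Qed.

Lemma common_rate_le x {O} {i j : 'I_N} :
  client_graph O i j -> common_rate x O <= link_rate x i j.
Proof.
move=> ij; apply: (@le_trans _ _ (user_rate x O i)); apply: minseq_le.
  by apply: map_f; rewrite mem_enum.
by apply: map_f; rewrite mem_filter ij mem_enum.
Qed.

(** Both nested minima run over nonempty lists, so the default value 0 of [minseq] never intervenes
    and comparing common rates reduces to comparing single links. *)
Lemma common_rate_attained x {O} : feasible O ->
  exists i j, client_graph O i j /\ common_rate x O = link_rate x i j.
Proof.
move=> fO.
have /minseq_mem/mapP[i _ ci] : [seq user_rate x O i | i <- enum 'I_N] != [::].
  by rewrite -size_eq0 size_map size_enum_ord -lt0n; lia.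
have [k ik] := feasible_neighbor i fO.
have /minseq_mem/mapP[j + cj] :
    [seq link_rate x i j | j <- enum 'I_N & client_graph O i j] != [::].
  apply/eqP => E.
  suff : link_rate x i k \in [::] by [].
  by rewrite -E; apply: map_f; rewrite mem_filter ik mem_enum.
rewrite mem_filter => /andP[ij _]; exists i, j; split => //.
by rewrite -cj -[RHS]ci.
Qed.

(** * Monotonicity of link rates and optimality of the chain *)

Lemma prefactor_ge0 : 0 <= 1 / (2 * (N%:R - 1)) :> R.
Proof.
have : 2%:R <= N%:R :> R by rewrite ler_nat.
by move=> h; apply: divr_ge0 => //; lra.
Qed.

Lemma log2_le (a b : R) : 0 < a -> a <= b -> log2 a <= log2 b.
Proof.
move=> a0 ab; rewrite /log2 ler_pM2r ?invr_gt0 ?ln_gt0 ?ltr1n//.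
by rewrite ler_ln// posrE// (lt_le_trans a0).
Qed.

Lemma link_rate_le x (u v a b : 'I_N) : (forall i, 0 < x i) ->
  x u <= x a -> x b <= x v -> link_rate x u v <= link_rate x a b.
Proof.
move=> x0 ua bv; have [[u0 v0] [a0 b0]] := ((x0 u, x0 v), (x0 a, x0 b)).
rewrite /link_rate ler_wpM2l ?prefactor_ge0// log2_le//.
  by rewrite addr_gt0// divr_gt0// addr_gt0.
apply: lerD => //.
rewrite ler_pdivrMr ?addr_gt0// mulrAC ler_pdivlMr ?addr_gt0//.
(* After clearing denominators and cancelling [x u * x a], this is all that remains of the
   comparison of fractions. *)
have : x u * x b <= x a * x v by apply: ler_pM => //; exact: ltW.
by nra.
Qed.

Lemma chain_optimal x O : snr_vector x -> feasible O ->
  common_rate x O <= common_rate x (chain_ordering N).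
Proof.
move=> [x0 xle] [_ _ [conn _]].
have [a [b [ab ->]]] := common_rate_attained x (chain_feasible N).
move: ab; rewrite chain_graphE => ab.
(* Cut the tree at the worst chain link: the first user is below the cut, and the last one above it
   because the larger of [a], [b] is still a user. *)
have [||u [v [uv /= um vm]]] :=
  @connect_cut _ _ [pred w : 'I_N | (w <= minn a b)%N] _ _
    (conn (first_user hN) (last_user hN)).
- by [].
- by rewrite /= -ltnNge; have := ltn_ord a; have := ltn_ord b; lia.
apply: (le_trans (common_rate_le x uv)).
(* Since [u] is at most min(a, b) and [v] at least max(a, b), both orientations of the chain link
   are covered. *)
by apply: link_rate_le => //; apply: xle; lia.
Qed.

(** * The gap bound and its limit *)

Lemma common_rate_gap x O : snr_vector x -> feasible O ->
  common_rate x (chain_ordering N) - common_rate x O <=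
    1 / (2 * (N%:R - 1)) *
    log2 ((1 + 2 * x (last_user hN)) / (2 * x (first_user hN))).
Proof.
move=> [x0 xle] /(common_rate_attained x)[a [b [_ ->]]].
set f := first_user hN; set l := last_user hN.
(* [Ordinal hN] has value 1, so it is the second user. *)
have f1 : client_graph (chain_ordering N) f (Ordinal hN) by rewrite chain_graphE.
apply: (le_trans (lerB (common_rate_le x f1) (lexx _))).
rewrite -mulrBr ler_wpM2l ?prefactor_ge0//.
have fl : x f <= x l by exact: xle.
have f0 := x0 f; have l0 := x0 l.
have -> : log2 ((1 + 2 * x l) / (2 * x f)) = log2 (x l + 1 / 2) - log2 (x f).
  rewrite /log2 -mulrBl -ln_div ?posrE//; last by lra.
  by congr (ln _ / _); field; rewrite lt0r_neq0.
apply: lerB; apply: log2_le => //.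
- by rewrite addr_gt0// divr_gt0// addr_gt0.
(* The second user is at least as strong as the first, so the fraction is at most 1/2. *)
- apply: lerD => //; rewrite ler_pdivrMr ?addr_gt0//.
  have : x f <= x (Ordinal hN) by exact: xle.
  by lra.
- have fa : x f <= x a by exact: xle.
  by apply: (le_trans fa); rewrite lerDl divr_ge0// ltW// addr_gt0.
Qed.

(** Squeeze the difference between 0, by optimality of the chain, and the gap bound, whose logarithm
    has an argument tending to 1. The filter [F] on indices expresses an arbitrary family of SNR
    vectors, with [O] varying along it. *)
Lemma common_rate_gap_cvg0 (T : Type) (F : set_system T) (FF : Filter F)
    (x : T -> 'I_N -> R) (O : T -> {set {set 'I_N}}) :
  (forall t, snr_vector (x t)) -> (forall t, feasible (O t)) ->
  x t (first_user hN) @[t --> F] --> +oo ->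
  x t (last_user hN) / x t (first_user hN) @[t --> F] --> (1 : R) ->
  common_rate (x t) (chain_ordering N) - common_rate (x t) (O t) @[t --> F]
    --> (0 : R).
Proof.
move=> xs fO xoo x1.
apply: (@squeeze_cvgr _ _ FF _ (fun=> 0) (fun t => 1 / (2 * (N%:R - 1)) *
    log2 ((1 + 2 * x t (last_user hN)) / (2 * x t (first_user hN))))).
- apply: nearW => t; rewrite common_rate_gap// andbT subr_ge0.
  exact: chain_optimal.
- exact: cvg_cst.
rewrite -[X in _ --> X](mulr0 (1 / (2 * (N%:R - 1)))).
apply: cvgM; first exact: cvg_cst.
have -> : (0 : R) = ln 1 / ln 2 by rewrite ln1 mul0r.
apply: cvgM; last exact: cvg_cst.
apply: continuous_cvg; first exact: continuous_ln.
(* Split the argument as 1/(2 x_1) + x_N/x_1: the first term vanishes in the limit and the second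
   tends to 1. *)
have -> : (fun t => (1 + 2 * x t (last_user hN)) / (2 * x t (first_user hN))) =
    (fun t => 2^-1 * (x t (first_user hN))^-1 +
      x t (last_user hN) / x t (first_user hN)).
  apply/funext => t; field; rewrite lt0r_neq0//; exact: (xs t).1.
rewrite -[X in _ --> X]add0r; apply: cvgD => //.
rewrite -[X in _ --> X](mulr0 2^-1).
apply: cvgM; first exact: cvg_cst.
apply/gtr0_cvgV0; last by [].
by apply: nearW => t; exact: (xs t).1.
Qed.

End Rates.

Theorem mainTheorem3 (R : realType) (N : nat) (hN : (2 <= N)%N) :
  feasible (chain_ordering N) /\
  (forall x : 'I_N -> R, snr_vector x ->
     forall O' : {set {set 'I_N}}, feasible O' ->
       common_rate x O' <= common_rate x (chain_ordering N)) /\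
  (forall x : 'I_N -> R, snr_vector x ->
     forall O' : {set {set 'I_N}}, feasible O' ->
       common_rate x (chain_ordering N) - common_rate x O' <=
         1 / (2 * (N%:R - 1)) *
         log2 ((1 + 2 * x (last_user hN)) / (2 * x (first_user hN)))) /\
  (forall (T : Type) (F : set_system T) (FF : Filter F)
          (x : T -> 'I_N -> R) (O' : T -> {set {set 'I_N}}),
     (forall t, snr_vector (x t)) ->
     (forall t, feasible (O' t)) ->
     x t (first_user hN) @[t --> F] --> +oo ->
     x t (last_user hN) / x t (first_user hN) @[t --> F] --> (1 : R) ->
     common_rate (x t) (chain_ordering N) - common_rate (x t) (O' t) @[t --> F]
       --> (0 : R)).
Proof.
split; first exact: chain_feasible.
split; first by move=> x xs O' fO'; exact: chain_optimal.
split; first by move=> x xs O' fO'; exact: common_rate_gap.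
by move=> T F FF x O'; exact: common_rate_gap_cvg0.
Qed.
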